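(* Every Boolean control network that is Type-4 observable is also Type-2 observable. The converse is not true: there exists a Boolean control network that is Type-2 observable but not Type-4 observable.
   Context: A Boolean control network (BCN, in algebraic form) is given by positive integers $n,m,q$, with $N=2^n$, $M=2^m$, $Q=2^q$, and a system $x(t+1)=Lu(t)x(t)$, $y(t)=Hx(t)$, $t=0,1,2,\dots$, with states $x(t)\in\Delta_N$, inputs $u(t)\in\Delta_M$, outputs $y(t)\in\Delta_Q$. Here $\Delta_k$ is the set of columns of the identity matrix $I_k$; $L$ is an $N\times NM$ matrix with all columns in $\Delta_N$ and $H$ is a $Q\times N$ matrix with all columns in $\Delta_Q$. Products are semi-tensor products; concretely $Lux=L(u\otimes x)$ for $u\in\Delta_M$, $x\in\Delta_N$, with $\otimes$ the Kronecker product. For $x_0\in\Delta_N$, $p\ge 1$ and $U=u_0\cdots u_{p-1}\in(\Delta_M)^p$, put $x_{t+1}=Lu_tx_t$ for $0\le t<p$ and $(HL)_{x_0}^p(U)=(Hx_1)\cdots(Hx_p)\in(\Delta_Q)^p$. For an infinite input sequence $U=u_0u_1\cdots\in(\Delta_M)^{\mathbb{N}}$, put likewise $(HL)_{x_0}^{\mathbb{N}}(U)=(Hx_1)(Hx_2)\cdots\in(\Delta_Q)^{\mathbb{N}}$ with $x_{t+1}=Lu_tx_t$ for all $t\ge 0$. Type-2 observability: for any distinct $x_0,\bar x_0\in\Delta_N$ there exist $p\ge1$ and $U\in(\Delta_M)^p$ such that $Hx_0=H\bar x_0$ implies $(HL)_{x_0}^p(U)\neq(HL)_{\bar x_0}^p(U)$.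 Type-4 observability: for any distinct $x_0,\bar x_0\in\Delta_N$ and any $U\in(\Delta_M)^{\mathbb{N}}$, $Hx_0=H\bar x_0$ implies $(HL)_{x_0}^{\mathbb{N}}(U)\neq(HL)_{\bar x_0}^{\mathbb{N}}(U)$. *)

(* Defs.v *)
From mathcomp Require Import all_boot all_algebra.
From mathcomp.real_closed Require Import mxtens.

Set Implicit Arguments.
Unset Strict Implicit.
Unset Printing Implicit Defensive.

Import GRing.Theory.
Local Open Scope ring_scope.

(* All vectors and matrices at play have entries 0 and 1; they are taken over
   the integers. *)
Definition Delta (k : nat) : {pred 'cV[int]_k} :=
  [pred x | [exists i : 'I_k, x == col i 1%:M]].
Arguments Delta k : clear implicits.

Record BCN := MkBCN {
  bcn_n : nat;
  bcn_m : nat;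
  bcn_q : nat;
  bcn_n_gt0 : (0 < bcn_n)%N;
  bcn_m_gt0 : (0 < bcn_m)%N;
  bcn_q_gt0 : (0 < bcn_q)%N;
  bcn_L : 'M[int]_(2 ^ bcn_n, 2 ^ bcn_m * 2 ^ bcn_n);
  bcn_H : 'M[int]_(2 ^ bcn_q, 2 ^ bcn_n);
  bcn_L_logical : forall j, col j bcn_L \in Delta (2 ^ bcn_n);
  bcn_H_logical : forall j, col j bcn_H \in Delta (2 ^ bcn_q)
}.

Notation state B := 'cV[int]_(2 ^ bcn_n B).
Notation input B := 'cV[int]_(2 ^ bcn_m B).
Notation output B := 'cV[int]_(2 ^ bcn_q B).

(* [*t] is the Kronecker product: the semi-tensor product L u x of a logical
   matrix with two vectors is the ordinary product of L with [u *t x]. The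
   latter has 1 * 1 columns, which is convertible to 1. *)
Definition bcn_step (B : BCN) (x : state B) (u : input B) : state B :=
  bcn_L B *m (u *t x).

Definition bcn_out (B : BCN) (x : state B) : output B := bcn_H B *m x.

(* [scanl] lists x_1, ..., x_p: the initial state x_0 is not included. *)
Definition out_word (B : BCN) (x0 : state B) (p : nat)
    (U : p.-tuple (input B)) : p.-tuple (output B) :=
  [tuple of map (@bcn_out B) (scanl (@bcn_step B) x0 U)].

Fixpoint trajectory (B : BCN) (x0 : state B) (U : nat -> input B) (t : nat) :
    state B :=
  if t is t'.+1 then bcn_step (trajectory x0 U t') (U t') else x0.

(* The output sequence starts with H x_1, not with H x_0. *)
Definition out_seq (B : BCN) (x0 : state B) (U : nat -> input B) :
    nat -> output B :=
  fun t => bcn_out (trajectory x0 U t.+1).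

Definition type2_observable (B : BCN) : Prop :=
  forall x0 x0' : state B,
    x0 \in Delta (2 ^ bcn_n B) -> x0' \in Delta (2 ^ bcn_n B) -> x0 <> x0' ->
  exists (p : nat) (U : p.-tuple (input B)),
    [/\ (1 <= p)%N,
        {subset U <= Delta (2 ^ bcn_m B)} &
        bcn_out x0 = bcn_out x0' -> out_word x0 U <> out_word x0' U].

Definition type4_observable (B : BCN) : Prop :=
  forall x0 x0' : state B,
    x0 \in Delta (2 ^ bcn_n B) -> x0' \in Delta (2 ^ bcn_n B) -> x0 <> x0' ->
  forall U : nat -> input B,
    (forall t, U t \in Delta (2 ^ bcn_m B)) ->
    bcn_out x0 = bcn_out x0' -> out_seq x0 U <> out_seq x0' U.

(* Main.v *)
Require Import Defs.
From mathcomp Require Import all_boot all_algebra.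
From mathcomp.real_closed Require Import mxtens.
From Stdlib Require Import Classical FunctionalExtensionality.

Set Implicit Arguments.
Unset Strict Implicit.
Unset Printing Implicit Defensive.

Import GRing.Theory.
Local Open Scope ring_scope.

(** Type-4 implies Type-2: feed the network one constant input sequence. If two
    distinct states have equal outputs, Type-4 observability makes the two
    infinite output sequences differ, hence differ at some finite time [t], and
    the input prefix of length [t + 1] already tells the states apart
    ([out_word_prefix]). If the outputs of the two states differ, any word of
    length 1 will do.

    The converse fails because Type-2 lets the input be chosen for the pair of
    states, while Type-4 demands that every input work. The counterexample is a
    two-bit shift register with reset: the output is the leading bit, one input
    shifts the trailing bit into the leading position, the other clears both
    bits. One shift reveals the trailing bit, so two states with the same
    leading bit can be told apart; clearing merges all states before the
    trailing bit is ever seen. *)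

(** * Finite input words as prefixes of input sequences *)

Lemma trajectory_foldl (B : BCN) (x0 : state B) (U : nat -> input B) t :
  trajectory x0 U t = foldl (@bcn_step B) x0 (mkseq U t).
Proof. by elim: t => // t IHt; rewrite mkseqS foldl_rcons -IHt. Qed.

Lemma out_word_prefix (B : BCN) (x0 : state B) (U : nat -> input B) p :
  out_word x0 [tuple of map U (iota 0 p)] = mkseq (out_seq x0 U) p :> seq _.
Proof.
have sz : size (scanl (@bcn_step B) x0 (mkseq U p)) = p.
  by rewrite size_scanl size_mkseq.
apply: (@eq_from_nth _ 0); rewrite /= size_map sz ?size_mkseq // => t lt_tp.
rewrite (nth_map 0) ?sz // nth_mkseq // /out_seq trajectory_foldl.
rewrite nth_scanl ?size_mkseq //.
by rewrite /mkseq -map_take take_iota (minn_idPl lt_tp).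
Qed.

Lemma Delta_col k (i : 'I_k) : col i 1%:M \in Delta k.
Proof. by apply/existsP; exists i. Qed.

Lemma Delta_colP k (x : 'cV[int]_k) :
  x \in Delta k -> exists i : 'I_k, x = col i 1%:M.
Proof. by case/existsP=> i /eqP ->; exists i. Qed.

Lemma col1_inj k : injective (fun i : 'I_k => col i (1%:M : 'M[int]_k)).
Proof.
move=> i j /matrixP/(_ i 0); rewrite !mxE eqxx.
by case: eqP.
Qed.

Lemma type4_type2 (B : BCN) : type4_observable B -> type2_observable B.
Proof.
move=> obs4 x0 x0' x0D x0'D neq_x.
pose U (_ : nat) : input B :=
  col (Ordinal (expn_gt0 2 (bcn_m B) : 0 < 2 ^ bcn_m B)%N) 1%:M.
have UD t : U t \in Delta (2 ^ bcn_m B) by apply: Delta_col.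
suff [t neq_t] : exists t, bcn_out x0 = bcn_out x0' ->
    out_seq x0 U t <> out_seq x0' U t.
  exists t.+1, [tuple of map U (iota 0 t.+1)]; split=> //.
    by move=> _ /mapP[s _ ->].
  move=> eq_out eq_word; apply: neq_t eq_out _.
  have := congr1 (fun w : _.-tuple _ => nth 0 w t) eq_word.
  by rewrite !out_word_prefix !nth_mkseq.
have [eq_out|neq_out] := classic (bcn_out x0 = bcn_out x0'); last by exists 0%N.
have neq_seq := obs4 _ _ x0D x0'D neq_x U UD eq_out.
have [t neq_t] : exists t, out_seq x0 U t <> out_seq x0' U t.
  apply: not_all_ex_not => eq_seq; apply: neq_seq.
  exact: functional_extensionality.
by exists t.
Qed.

(** * Logical matrices of functions on indices *)

Definition logical_mx r c (f : 'I_c -> 'I_r) : 'M[int]_(r, c) :=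
  \matrix_(i, j) (i == f j)%:R.

Lemma col_logical_mx r c (f : 'I_c -> 'I_r) j :
  col j (logical_mx f) = col (f j) 1%:M.
Proof. by apply/matrixP=> i k; rewrite !mxE. Qed.

Lemma logical_mx_Delta r c (f : 'I_c -> 'I_r) j :
  col j (logical_mx f) \in Delta r.
Proof. by rewrite col_logical_mx Delta_col. Qed.

Lemma mul_logical_mx r c (f : 'I_c -> 'I_r) j :
  logical_mx f *m col j 1%:M = col (f j) 1%:M.
Proof. by rewrite col1 -colE col_logical_mx. Qed.

Lemma tens_col1 a b (i : 'I_a) (j : 'I_b) :
  (col i 1%:M : 'cV[int]_a) *t (col j 1%:M : 'cV[int]_b)
  = col (mxtens_index (i, j)) 1%:M :> 'cV[int]_(a * b).
Proof.
apply/matrixP=> k z; case: (mxtens_indexP k) => i' j'.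
rewrite !mxE mxtens_indexK /= -natrM mulnb.
by rewrite (inj_eq (can_inj (@mxtens_indexK _ _))) xpair_eqE.
Qed.

(** * The shift register with reset *)

(** The states are 0, 1, 2, 3, read as two-bit numbers: doubling modulo 4 is
    the shift, and multiplication by the input index 0 is the reset. *)
Definition register_next (k : 'I_(2 ^ 1 * 2 ^ 2)) : 'I_(2 ^ 2) :=
  let: (i, j) := @mxtens_unindex (2 ^ 1) (2 ^ 2) k in
  (inZp (i * (2 * j)) : 'I_4).

Definition register_out (j : 'I_(2 ^ 2)) : 'I_(2 ^ 1) := (inZp (j %/ 2) : 'I_2).

Definition register : BCN :=
  @MkBCN 2 1 1 isT isT isT (logical_mx register_next) (logical_mx register_out)
    (logical_mx_Delta register_next) (logical_mx_Delta register_out).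

Notation e4 j := (col j 1%:M : state register).
Notation e2 i := (col i 1%:M : input register).

Lemma register_step (i : 'I_(2 ^ 1)) (j : 'I_(2 ^ 2)) :
  bcn_step (e4 j) (e2 i) = e4 (inZp (i * (2 * j)) : 'I_4).
Proof.
rewrite /bcn_step /= tens_col1.
rewrite [LHS](mul_logical_mx register_next) /register_next.
by rewrite mxtens_indexK.
Qed.

Lemma register_outE (j : 'I_(2 ^ 2)) :
  bcn_out (e4 j) = col (register_out j) 1%:M.
Proof. exact: mul_logical_mx. Qed.

Lemma register_type2 : type2_observable register.
Proof.
move=> _ _ /Delta_colP[j ->] /Delta_colP[j' ->] neq_j.
exists 1%N, [tuple e2 (1 : 'I_2)]; split=> //.
  by move=> u; rewrite inE => /eqP->; apply: Delta_col.
rewrite !register_outE => /col1_inj eq_lead /(congr1 val) /=.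
rewrite !register_step !register_outE => -[/col1_inj eq_trail].
apply: neq_j; congr (col _ _); apply: val_inj.
move: (congr1 val eq_lead) (congr1 val eq_trail).
by case: j {eq_lead eq_trail} => [[|[|[|[|?]]]] ?] //;
   case: j' => [[|[|[|[|?]]]] ?].
Qed.

Lemma register_not_type4 : ~ type4_observable register.
Proof.
(* The states 00 and 01 share their leading bit, and the first reset sends
   both to 00. *)
pose U (_ : nat) := e2 (0 : 'I_2).
move/(_ (e4 (0 : 'I_4)) (e4 (1 : 'I_4)) (Delta_col _) (Delta_col _)).
case/(_ _ U (fun=> Delta_col _)) => [/col1_inj // | |].
  by rewrite !register_outE; congr (col _ _); apply: val_inj.
apply: functional_extensionality => t; congr (bcn_out _).
elim: t => [|t /= -> //].
by rewrite /= !register_step; congr (col _ _); apply: val_inj.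
Qed.

Theorem mainTheorem10 :
  (forall B : BCN, type4_observable B -> type2_observable B) /\
  (exists B : BCN, type2_observable B /\ ~ type4_observable B).
Proof.
split; first exact: type4_type2.
by exists register; split; [apply: register_type2 | apply: register_not_type4].
Qed.
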